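(* Every uniformly effectively inseparable c.e. pre-lattice $L$ is uniformly dense: there is a computable function $f(a,b)$ such that for all $a,b$, if $a<_L b$ then $a<_L f(a,b)<_L b$, and for all $a,b,a',b'$ with $a\equiv_L a'$ and $b\equiv_L b'$ one has $f(a,b)\equiv_L f(a',b')$.
   Context: $W_u$ denotes the $u$-th c.e. set. A c.e. pre-lattice is a structure $L=\langle\omega,\wedge,\vee,\leq_L\rangle$ with $\wedge,\vee$ computable binary operations and $\leq_L$ a c.e. pre-ordering (reflexive transitive) relation, such that the equivalence relation $\equiv_L$ ($x\equiv_L y$ iff $x\leq_L y$ and $y\leq_L x$) is a congruence and the quotient $L/{\equiv_L}$, ordered by the partial order induced by $\leq_L$, is a lattice in which $\wedge$ and $\vee$ induce meet and join. Neither distributivity nor boundedness is assumed. $a<_L b$ means $a\leq_L b$ and $b\not\leq_L a$. A disjoint pair $(A,B)$ of sets is effectively inseparable with productive function $\psi$ if $\psi(u,v)$ is partial computable and whenever $A\subseteq W_u$, $B\subseteq W_v$ and $W_u\cap W_v=\emptyset$, then $\psi(u,v)$ is defined and $\psi(u,v)\notin W_u\cup W_v$. A c.e. pre-lattice $L$ is uniformly effectively inseparable (u.e.i.) if $\equiv_L$ has at least two classes and there is a partial computable function $\chi(x,y,u,v)$ such that whenever $x\not\equiv_L y$, the function $\psi(u,v)=\chi(x,y,u,v)$ is a productive function for the pair $([x]_L,[y]_L)$ of $\equiv_L$-classes. *)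

(* Defs.v *)
From Stdlib Require Import Arith.
From Stdlib Require Cantor.

Set Implicit Arguments.
Unset Strict Implicit.

Notation "<| x , y |>" := (Cantor.to_nat (x, y)) (at level 0, x, y at level 99).

(* Programs for the unary partial recursive functions.  Functions of several
   arguments are computed on tuples coded by the Cantor pairing <|x, y|>. *)
Inductive code : Set :=
| cZero
| cSucc
| cFst
| cSnd
| cPair (c d : code)
| cComp (c d : code)
| cPrec (c d : code)
| cMu (c : code).

(* [eval c x y]: program [c] halts on input [x] with output [y]. *)
Inductive eval : code -> nat -> nat -> Prop :=
| eval_zero x : eval cZero x 0
| eval_succ x : eval cSucc x (S x)
| eval_fst x y : eval cFst <|x, y|> x
| eval_snd x y : eval cSnd <|x, y|> y
| eval_pair c d x y z :
    eval c x y -> eval d x z -> eval (cPair c d) x <|y, z|>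
| eval_comp c d x y z :
    eval d x y -> eval c y z -> eval (cComp c d) x z
| eval_prec0 c d x y :
    eval c x y -> eval (cPrec c d) <|x, 0|> y
| eval_precS c d x n y z :
    eval (cPrec c d) <|x, n|> y -> eval d <|x, <|n, y|> |> z ->
    eval (cPrec c d) <|x, S n|> z
(* Unbounded search: [c] must halt with a nonzero value (here [S (g m)])
   at every [m] below the value returned. *)
| eval_mu c x n (g : nat -> nat) :
    (forall m, m < n -> eval c <|x, m|> (S (g m))) -> eval c <|x, n|> 0 ->
    eval (cMu c) x n.

Lemma eval_functional c x y z : eval c x y -> eval c x z -> y = z.
Proof.
intros H; revert z.
induction H as [| | | |c d x y z _ IH1 _ IH2|c d x y z _ IH1 _ IH2| |
                c d x n y z _ IH1 _ IH2|c x n g _ IHlt _ IH0];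
  intros w Hw;
  match type of Hw with eval _ ?q _ => remember q as p eqn:Ep in Hw end;
  inversion Hw; subst;
  repeat match goal with
  | E : Cantor.to_nat _ = Cantor.to_nat _ |- _ =>
      apply Cantor.to_nat_inj in E; injection E; clear E; intros; subst
  end; try discriminate; auto.
- f_equal; f_equal; auto.
- match goal with E : eval d x _ |- _ => apply IH1 in E; subst end; auto.
- match goal with E : eval (cPrec c d) _ _ |- _ =>
    apply IH1 in E; subst end; auto.
- destruct (Nat.lt_trichotomy n w) as [Hlt | [Heq | Hlt]]; auto; exfalso.
  + match goal with E : forall m, m < w -> _ |- _ =>
      specialize (E n Hlt); apply IH0 in E end; discriminate.
  + match goal with E : eval c _ 0 |- _ =>
      apply (IHlt w Hlt) in E end; discriminate.
Qed.

(* Gödel numbers. *)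
Fixpoint encode (c : code) : nat :=
  match c with
  | cZero => <|0, 0|>
  | cSucc => <|1, 0|>
  | cFst => <|2, 0|>
  | cSnd => <|3, 0|>
  | cPair c d => <|4, <|encode c, encode d|> |>
  | cComp c d => <|5, <|encode c, encode d|> |>
  | cPrec c d => <|6, <|encode c, encode d|> |>
  | cMu c => <|7, encode c|>
  end.

Lemma encode_inj c d : encode c = encode d -> c = d.
Proof.
revert d; induction c; intros []; cbn [encode]; intros H;
  apply Cantor.to_nat_inj in H; try discriminate; auto.
1-3: assert (H1 := f_equal snd H); cbn [snd] in H1;
  apply Cantor.to_nat_inj in H1; injection H1; intros; f_equal; auto.
assert (H1 := f_equal snd H); cbn [snd] in H1; f_equal; auto.
Qed.

(* [W u x]: [x] lies in the [u]-th c.e. set, the domain of the program with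
   Gödel number [u]; the set is empty when [u] is not a Gödel number. *)
Definition W (u x : nat) : Prop :=
  exists c y, encode c = u /\ eval c x y.

Definition computable2 (f : nat -> nat -> nat) : Prop :=
  exists c, forall x y, eval c <|x, y|> (f x y).

(* Partial functions are given by their graphs: [psi u v z] reads
   "psi(u, v) is defined and equal to z". *)
Definition partial_computable2 (psi : nat -> nat -> nat -> Prop) : Prop :=
  exists c, forall u v z, psi u v z <-> eval c <|u, v|> z.

Definition partial_computable4
    (chi : nat -> nat -> nat -> nat -> nat -> Prop) : Prop :=
  exists c, forall x y u v z,
    chi x y u v z <-> eval c <|x, <|y, <|u, v|> |> |> z.

Definition ce_relation (R : nat -> nat -> Prop) : Prop :=
  exists e, forall x y, R x y <-> W e <|x, y|>.

Definition subset (A B : nat -> Prop) : Prop := forall x, A x -> B x.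
Definition disjoint (A B : nat -> Prop) : Prop := forall x, ~ (A x /\ B x).

Definition effectively_inseparable_with
    (A B : nat -> Prop) (psi : nat -> nat -> nat -> Prop) : Prop :=
  disjoint A B /\
  partial_computable2 psi /\
  forall u v, subset A (W u) -> subset B (W v) -> disjoint (W u) (W v) ->
    exists z, psi u v z /\ ~ W u z /\ ~ W v z.

Definition equiv_of (R : nat -> nat -> Prop) (x y : nat) : Prop :=
  R x y /\ R y x.

(* The fields from [meet_lel] on say, on representatives, that the induced
   operations are the binary infimum and supremum in the quotient order. *)
Record ce_prelattice : Type := {
  meet : nat -> nat -> nat;
  join : nat -> nat -> nat;
  leL : nat -> nat -> Prop;
  meet_computable : computable2 meet;
  join_computable : computable2 join;
  le_ce : ce_relation leL;
  le_refl : forall x, leL x x;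
  le_trans : forall x y z, leL x y -> leL y z -> leL x z;
  meet_congr : forall x x' y y', equiv_of leL x x' -> equiv_of leL y y' ->
    equiv_of leL (meet x y) (meet x' y');
  join_congr : forall x x' y y', equiv_of leL x x' -> equiv_of leL y y' ->
    equiv_of leL (join x y) (join x' y');
  meet_lel : forall x y, leL (meet x y) x;
  meet_ler : forall x y, leL (meet x y) y;
  meet_glb : forall x y z, leL z x -> leL z y -> leL z (meet x y);
  join_gel : forall x y, leL x (join x y);
  join_ger : forall x y, leL y (join x y);
  join_lub : forall x y z, leL x z -> leL y z -> leL (join x y) z
}.

Definition equiv (L : ce_prelattice) : nat -> nat -> Prop := equiv_of (leL L).

Definition ltL (L : ce_prelattice) (a b : nat) : Prop :=
  leL L a b /\ ~ leL L b a.

Definition eqclass (L : ce_prelattice) (x : nat) : nat -> Prop :=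
  fun z => equiv L x z.

Definition uei (L : ce_prelattice) : Prop :=
  (exists x y, ~ equiv L x y) /\
  exists chi, partial_computable4 chi /\
    forall x y, ~ equiv L x y ->
      effectively_inseparable_with (eqclass L x) (eqclass L y) (chi x y).

Definition uniformly_dense (L : ce_prelattice) : Prop :=
  exists f : nat -> nat -> nat, computable2 f /\
    (forall a b, ltL L a b -> ltL L a (f a b) /\ ltL L (f a b) b) /\
    (forall a b a' b', equiv L a a' -> equiv L b b' ->
       equiv L (f a b) (f a' b')).

(* Main.v *)
Require Import Defs.
From Stdlib Require Import Arith Lia Classical IndefiniteDescription.
From Stdlib Require Cantor.

Set Implicit Arguments.
Unset Strict Implicit.

(** A pair [(a, b)] is coded by [n = <|a, b|>] and stands for the interval from
    [lo n = a] to [hi n = a \/ b]; when [a <= b] the upper end is equivalent to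
    [b].  The interpolants are defined by course-of-values recursion:
    [[
      f n = lo n \/ (hi n /\ (t n n \/ (join over m < n of f m /\ t n m)))
    ]]
    The outer clipping puts [f n] in its interval, and the auxiliary elements
    [t n k] are switches.  The following events are c.e. in [n]:
    - event [m], for [m < n]: the intervals [n] and [m] are equivalent;
    - event [n]: [f n <= lo n];
    - event [S n]: [hi n <= f n].

    If [lo n < hi n] and some event ever occurs, then the first one found, say
    [k'], sets the switches: [t n k'] becomes equivalent to [hi n] and every
    other [t n k] to [lo n].  So event [m] makes [f n] equivalent to [f m].
    Event [n] would make [f n] equivalent to [hi n], and event [S n] would make
    it equivalent to [lo n], in contradiction with the event itself; so [f n]
    is strictly inside a proper interval ([interpolant_strict]).  Since every
    earlier equivalent interval is an event, induction gives that equivalent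
    intervals have equivalent interpolants ([interpolant_extensional]).  Where
    the interval collapses, clipping alone makes everything equivalent.

    The switches come from effective inseparability.  Put
    [t n k = chi (lo n) (hi n) u v], where, by self-reference, [u] and [v] are
    indices with [W u] the class of [lo n], together with [t n k] if the first
    event is [k], and [W v] the class of [hi n], together with [t n k] if the
    first event is another one.  The productive value [t n k] lies outside
    [W u] and [W v] when these are disjoint; so once it has been put into one of
    them they must meet, and they can only meet if [t n k] is in the class that
    the other one started from ([forcing_system]).

    No universal program is needed.  Only finitely many fixed programs are ever
    run, and for a fixed program evaluation with a bound on the resources is a
    total computable function, by induction on the program ([step_computable]).
    The c.e. predicates are then the projections of zero sets of total
    computable functions.  They are closed under conjunction, disjunction and
    existential quantification, and they have computable selectors
    ([enumerable_uniformization]); a selector picks the first event.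
    Self-reference reduces to substituting a constant into a program and
    applying a program to its own Goedel number ([self_reference]). *)

Notation pi1 x := (fst (Cantor.of_nat x)).
Notation pi2 x := (snd (Cantor.of_nat x)).

Lemma pi1_pair x y : pi1 <|x, y|> = x.
Proof. now rewrite Cantor.cancel_of_to. Qed.

Lemma pi2_pair x y : pi2 <|x, y|> = y.
Proof. now rewrite Cantor.cancel_of_to. Qed.

Lemma pair_pi p : <|pi1 p, pi2 p|> = p.
Proof. rewrite <- surjective_pairing; apply Cantor.cancel_to_of. Qed.

Opaque Cantor.to_nat Cantor.of_nat.

Ltac unpair := repeat (rewrite pi1_pair || rewrite pi2_pair).

(** * Computable functions *)

(** [f] is computed, on the inputs in [D], by some program.  Nothing is asked
    outside [D], so a partial computable function can be handled through any
    total function that extends it. *)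
Definition computable_on (D : nat -> Prop) (f : nat -> nat) : Prop :=
  exists c, forall x, D x -> eval c x (f x).

Definition computable : (nat -> nat) -> Prop := computable_on (fun _ => True).

Lemma computable_on_ext D f g :
  (forall x, D x -> f x = g x) -> computable_on D f -> computable_on D g.
Proof.
intros E [c H]; exists c; intros x Hx; rewrite <- E by trivial; auto.
Qed.

Lemma computable_on_comp D D' f g :
  computable_on D' f -> computable_on D g -> (forall x, D x -> D' (g x)) ->
  computable_on D (fun x => f (g x)).
Proof.
intros [c Hc] [d Hd] HD; exists (cComp c d); intros x Hx.
eapply eval_comp; eauto.
Qed.

Lemma computable_comp D f g :
  computable f -> computable_on D g -> computable_on D (fun x => f (g x)).
Proof. intros Hf Hg; exact (computable_on_comp Hf Hg (fun _ _ => I)). Qed.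

Lemma computable_on_pi1 D f :
  computable_on D f -> computable_on D (fun x => pi1 (f x)).
Proof.
intros [c Hc]; exists (cComp cFst c); intros x Hx.
eapply eval_comp; [eauto|]; rewrite <- (pair_pi (f x)) at 1; apply eval_fst.
Qed.

Lemma computable_on_pi2 D f :
  computable_on D f -> computable_on D (fun x => pi2 (f x)).
Proof.
intros [c Hc]; exists (cComp cSnd c); intros x Hx.
eapply eval_comp; [eauto|]; rewrite <- (pair_pi (f x)) at 1; apply eval_snd.
Qed.

Lemma computable_on_pair D f g :
  computable_on D f -> computable_on D g ->
  computable_on D (fun x => <|f x, g x|>).
Proof.
intros [c Hc] [d Hd]; exists (cPair c d); intros x Hx.
apply eval_pair; auto.
Qed.

(** The program of the identity. *)
Definition cId : code := cPair cFst cSnd.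

Lemma eval_id x : eval cId x x.
Proof.
rewrite <- (pair_pi x) at 2; apply eval_pair;
  rewrite <- (pair_pi x) at 1; constructor.
Qed.

Lemma computable_on_id D : computable_on D (fun x => x).
Proof. exists cId; intros; apply eval_id. Qed.

Lemma computable_on_succ D f :
  computable_on D f -> computable_on D (fun x => S (f x)).
Proof.
intros [c Hc]; exists (cComp cSucc c); intros x Hx.
eapply eval_comp; [eauto|constructor].
Qed.

(** The program of the constant function with value [k]. *)
Fixpoint cConst (k : nat) : code :=
  match k with 0 => cZero | S k => cComp cSucc (cConst k) end.

Lemma eval_const k x : eval (cConst k) x k.
Proof.
induction k as [|k IH]; cbn; [constructor|eapply eval_comp; [eauto|constructor]].
Qed.

Lemma computable_on_const D k : computable_on D (fun _ => k).
Proof. exists (cConst k); intros; apply eval_const. Qed.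

(** Primitive recursion: [prec b s n] iterates [s] from [b], [n] times. *)
Fixpoint prec (b : nat) (s : nat -> nat -> nat) (n : nat) : nat :=
  match n with 0 => b | S n => s n (prec b s n) end.

Lemma computable_on_prec D b s k :
  computable_on D b ->
  computable_on (fun p => D (pi1 p))
    (fun p => s (pi1 p) (pi1 (pi2 p)) (pi2 (pi2 p))) ->
  computable_on D k ->
  computable_on D (fun x => prec (b x) (s x) (k x)).
Proof.
intros [c Hc] [d Hd] [e He].
exists (cComp (cPrec c d) (cPair cId e)); intros x Hx.
apply eval_comp with <|x, k x|>; [apply eval_pair; [apply eval_id|auto]|].
induction (k x) as [|n IH]; cbn.
- apply eval_prec0; auto.
- eapply eval_precS; [exact IH|].
  specialize (Hd <|x, <|n, prec (b x) (s x) n|> |>).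
  cbv beta in Hd; revert Hd; unpair; auto.
Qed.

(** The hypothesis is the computability of a binary function, on coded pairs. *)
Lemma computable_on_app2 D f a b :
  computable (fun p => f (pi1 p) (pi2 p)) ->
  computable_on D a -> computable_on D b ->
  computable_on D (fun x => f (a x) (b x)).
Proof.
intros Hf Ha Hb.
eapply computable_on_ext;
  [|eapply (computable_comp Hf), (computable_on_pair Ha Hb)].
intros x _; cbv beta; now unpair.
Qed.

Lemma computable_on_app3 D D' f a b c :
  computable_on D' (fun p => f (pi1 p) (pi1 (pi2 p)) (pi2 (pi2 p))) ->
  computable_on D a -> computable_on D b -> computable_on D c ->
  (forall x, D x -> D' <|a x, <|b x, c x|> |>) ->
  computable_on D (fun x => f (a x) (b x) (c x)).
Proof.
intros Hf Ha Hb Hc HD.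
eapply computable_on_ext;
  [|eapply computable_on_comp;
    [exact Hf|apply (computable_on_pair Ha (computable_on_pair Hb Hc))|exact HD]].
intros x _; cbv beta; now unpair.
Qed.

Lemma computable_on_op2 D f a b :
  computable2 f -> computable_on D a -> computable_on D b ->
  computable_on D (fun x => f (a x) (b x)).
Proof.
intros [c Hc]; apply computable_on_app2; exists c; intros p _.
rewrite <- (pair_pi p) at 1; apply Hc.
Qed.

Lemma computable_on_case D k a b :
  computable_on D k -> computable_on D a ->
  computable_on (fun p => D (pi1 p)) (fun p => b (pi1 p) (pi2 p)) ->
  computable_on D (fun x => match k x with 0 => a x | S m => b x m end).
Proof.
intros Hk Ha Hb.
apply computable_on_ext with (fun x => prec (a x) (fun m _ => b x m) (k x)).
- intros x _; now destruct (k x).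
- apply computable_on_prec; trivial.
  eapply computable_on_ext;
    [|eapply computable_on_comp; [exact Hb| |]].
  2: apply computable_on_pair; [apply computable_on_pi1, computable_on_id
       |apply computable_on_pi1, computable_on_pi2, computable_on_id].
  + intros p _; cbv beta; now unpair.
  + intros p; cbv beta; now unpair.
Qed.

(** Proves computability by following the structure of the function; [tac]
    supplies the closure lemmas specific to the case at hand. *)
Ltac computability_with tac :=
  repeat first
    [ assumption
    | apply computable_on_const
    | apply computable_on_id
    | apply computable_on_pair
    | tac
    | apply computable_on_pi1
    | apply computable_on_pi2
    | apply computable_on_succ
    | apply computable_on_case
    | apply computable_on_prec ].

Ltac computability := computability_with fail.

Lemma computable_on_add D f g :
  computable_on D f -> computable_on D g ->
  computable_on D (fun x => f x + g x).
Proof.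
intros Hf Hg.
apply computable_on_ext with (fun x => prec (g x) (fun _ r => S r) (f x)).
- intros x _; induction (f x); cbn; auto.
- computability.
Qed.

Lemma computable_on_sub D f g :
  computable_on D f -> computable_on D g ->
  computable_on D (fun x => f x - g x).
Proof.
intros Hf Hg.
apply computable_on_ext
  with (fun x => prec (f x) (fun _ r => match r with 0 => 0 | S m => m end) (g x)).
- intros x _; induction (g x) as [|m IH]; cbn; [lia|].
  rewrite IH; destruct (f x - m) eqn:E; lia.
- computability.
Qed.

Lemma computable_on_mul D f g :
  computable_on D f -> computable_on D g ->
  computable_on D (fun x => f x * g x).
Proof.
intros Hf Hg.
apply computable_on_ext with (fun x => prec 0 (fun _ r => g x + r) (f x)).
- intros x _; induction (f x); cbn; auto.
- computability; apply computable_on_add; computability.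
  destruct Hg as [c Hc]; exists (cComp c cFst); intros p Hp.
  apply eval_comp with (pi1 p); auto.
  rewrite <- (pair_pi p) at 1; apply eval_fst.
Qed.

(** * Step-bounded evaluation *)

(** Evaluation of [c] on [x] with bound [s]: the value is [S y] if the output
    [y] was found and [0] if nothing was found.  The bound only limits the
    searches of [cMu].  The state of such a search is [0] when a value of the
    body is not available, [1] while the search goes on, and [S (S n)] once the
    root [n] has been found. *)
Fixpoint step (c : code) (s x : nat) : nat :=
  match c with
  | cZero => 1
  | cSucc => S (S x)
  | cFst => S (pi1 x)
  | cSnd => S (pi2 x)
  | cPair c d =>
      match step c s x with
      | 0 => 0
      | S y => match step d s x with 0 => 0 | S z => S <|y, z|> end
      end
  | cComp c d => match step d s x with 0 => 0 | S y => step c s y end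
  | cPrec c d =>
      prec (step c s (pi1 x))
        (fun n r => match r with
                    | 0 => 0
                    | S y => step d s <|pi1 x, <|n, y|> |>
                    end) (pi2 x)
  | cMu c =>
      match prec 1
        (fun n r => match r with
                    | 0 => 0
                    | S r' => match r' with
                      | 0 => match step c s <|x, n|> with
                             | 0 => 0
                             | S y => match y with 0 => S (S n) | S _ => 1 end
                             end
                      | S m => S (S m)
                      end
                    end) s
      with 0 => 0 | S r => r end
  end.

Lemma step_computable c : computable (fun p => step c (pi1 p) (pi2 p)).
Proof.
unfold computable.
assert (K : forall D f a b, computable (fun p => f (pi1 p) (pi2 p)) ->
  computable_on D a -> computable_on D b ->
  computable_on D (fun x => f (a x) (b x))) by apply computable_on_app2.
unfold computable in K.
induction c; cbn [step];
  computability_with ltac:(apply computable_on_app2; [eassumption| |]).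
Qed.

Lemma step_sound c s : forall x y, step c s x = S y -> eval c x y.
Proof.
induction c as [| | | |c IHc d IHd|c IHc d IHd|c IHc d IHd|c IHc];
  cbn [step]; intros x y H.
- injection H as <-; constructor.
- injection H as <-; constructor.
- injection H as <-; rewrite <- (pair_pi x) at 1; constructor.
- injection H as <-; rewrite <- (pair_pi x) at 1; constructor.
- destruct (step c s x) eqn:E1; [discriminate|].
  destruct (step d s x) eqn:E2; [discriminate|].
  injection H as <-; apply eval_pair; auto.
- destruct (step d s x) eqn:E; [discriminate|]; eapply eval_comp; eauto.
- rewrite <- (pair_pi x); revert y H.
  generalize (pi1 x) as a, (pi2 x) as n; intros a n.
  induction n as [|n IH]; cbn [prec]; intros y H.
  + apply eval_prec0; auto.
  + match type of H with match ?r with _ => _ end = _ =>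
      destruct r eqn:E; [discriminate|] end.
    eapply eval_precS; eauto.
- match type of H with match prec _ ?f _ with _ => _ end = _ =>
    set (F := f) in H end.
  (* Invariant of the search after [k] rounds. *)
  assert (K : forall k,
    (prec 1 F k = 1 -> forall m, m < k -> exists g, eval c <|x, m|> (S g)) /\
    (forall n, prec 1 F k = S (S n) ->
       eval c <|x, n|> 0 /\ forall m, m < n -> exists g, eval c <|x, m|> (S g))).
  { intros k; induction k as [|k [IH1 IH2]]; cbn [prec].
    - split; [lia|discriminate].
    - destruct (prec 1 F k) as [|[|r]]; cbn.
      + split; discriminate.
      + destruct (step c s <|x, k|>) as [|[|y']] eqn:E.
        * split; discriminate.
        * split; [discriminate|]; intros n Hn; injection Hn as <-; auto.
        * split; [|discriminate]; intros _ m Hm.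
          destruct (Nat.eq_dec m k) as [->|]; [eauto|apply IH1; auto; lia].
      + split; [discriminate|]; intros n Hn; injection Hn as <-.
        now apply IH2. }
  destruct (K s) as [_ K2].
  destruct (prec 1 F s) as [|[|r]]; try discriminate; injection H as ->.
  destruct (K2 y eq_refl) as [H0 H1].
  destruct (functional_choice
    (fun m g => m < y -> eval c <|x, m|> (S g))) as [g Hg].
  { intros m; destruct (le_lt_dec y m) as [|Hm]; [exists 0; lia|].
    destruct (H1 m Hm) as [g Hg]; eauto. }
  apply eval_mu with g; auto.
Qed.

(** The output is found for all large bounds; this form makes monotonicity of
    [step] in the bound unnecessary. *)
Lemma step_complete c x y :
  eval c x y -> exists s0, forall s, s0 <= s -> step c s x = S y.
Proof.
induction 1 as [| | | |c d x y z _ [s1 IH1] _ [s2 IH2]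
               |c d x y z _ [s1 IH1] _ [s2 IH2]
               |c d x y _ [s1 IH1]
               |c d x n y z _ [s1 IH1] _ [s2 IH2]
               |c x n g _ IHlt _ [s2 IH0]]; cbn [step];
  try (exists 0; intros; unpair; reflexivity).
- exists (s1 + s2); intros s Hs; rewrite IH1, IH2 by lia; reflexivity.
- exists (s1 + s2); intros s Hs; rewrite IH1, IH2 by lia; reflexivity.
- exists s1; intros s Hs; unpair; cbn; auto.
- exists (s1 + s2); intros s Hs; unpair; cbn [prec].
  specialize (IH1 s ltac:(lia)); cbn [step] in IH1; revert IH1; unpair.
  intros ->; apply IH2; lia.
- assert (exists s1, forall s m, s1 <= s -> m < n ->
    step c s <|x, m|> = S (S (g m))) as [s1 H1].
  { clear IH0 s2; induction n as [|n IH]; [exists 0; lia|].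
    destruct IH as [s1 H1]; [auto|]; destruct (IHlt n) as [s2 H2]; [lia|].
    exists (s1 + s2); intros s m Hs Hm.
    destruct (Nat.eq_dec m n) as [->|]; [apply H2|apply H1]; lia. }
  exists (S (s1 + s2 + n)); intros s Hs.
  match goal with |- match prec _ ?f _ with _ => _ end = _ => set (F := f) end.
  assert (K1 : forall k, k <= n -> prec 1 F k = 1).
  { intros k; induction k as [|k IH]; cbn [prec]; trivial; intros Hk.
    rewrite IH by lia; cbn; now rewrite H1 by lia. }
  assert (K2 : forall k, prec 1 F (S n + k) = S (S n)).
  { intros k; induction k as [|k IH].
    - rewrite Nat.add_0_r; cbn [prec]; rewrite K1 by lia; cbn.
      now rewrite IH0 by lia.
    - rewrite Nat.add_succ_r; cbn [prec]; now rewrite IH. }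
  replace s with (S n + (s - S n)) by lia; now rewrite K2.
Qed.

(** * Computably enumerable predicates *)

(** The projection of the zero set of a total computable function. *)
Definition enumerable (P : nat -> Prop) : Prop :=
  exists g, computable g /\ forall x, P x <-> exists s, g <|x, s|> = 0.

Lemma enumerable_zero f : computable f -> enumerable (fun x => f x = 0).
Proof.
intros Hf; exists (fun p => f (pi1 p)); split.
- eapply (computable_comp Hf); computability.
- intros x; split; [intros H; exists 0|intros [s H]; revert H]; now unpair.
Qed.

Lemma enumerable_ext P Q :
  (forall x, P x <-> Q x) -> enumerable P -> enumerable Q.
Proof.
intros E [g [Hg H]]; exists g; split; trivial; intros x; now rewrite <- E.
Qed.

Lemma enumerable_lt f g :
  computable f -> computable g -> enumerable (fun x => f x < g x).
Proof.
intros Hf Hg.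
apply enumerable_ext with (fun x => S (f x) - g x = 0); [lia|].
apply enumerable_zero, computable_on_sub; trivial; now apply computable_on_succ.
Qed.

Lemma enumerable_or P Q :
  enumerable P -> enumerable Q -> enumerable (fun x => P x \/ Q x).
Proof.
intros [f [Hf HP]] [g [Hg HQ]]; exists (fun p => f p * g p); split.
- now apply computable_on_mul.
- intros x; rewrite HP, HQ; split.
  + intros [[s Hs]|[s Hs]]; exists s; rewrite Hs; lia.
  + intros [s Hs]; apply Nat.eq_mul_0 in Hs as []; eauto.
Qed.

Lemma enumerable_and P Q :
  enumerable P -> enumerable Q -> enumerable (fun x => P x /\ Q x).
Proof.
intros [f [Hf HP]] [g [Hg HQ]].
exists (fun p => f <|pi1 p, pi1 (pi2 p)|> + g <|pi1 p, pi2 (pi2 p)|>); split.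
- apply computable_on_add; [eapply (computable_comp Hf)|eapply (computable_comp Hg)];
    computability.
- intros x; rewrite HP, HQ; split.
  + intros [[s Hs] [t Ht]]; exists <|s, t|>; unpair; lia.
  + intros [s Hs]; revert Hs; unpair; intros Hs; split; eexists;
      [instantiate (1 := pi1 s)|instantiate (1 := pi2 s)]; lia.
Qed.

Lemma enumerable_ex (P : nat -> nat -> Prop) :
  enumerable (fun p => P (pi1 p) (pi2 p)) -> enumerable (fun x => exists y, P x y).
Proof.
intros [g [Hg H]].
exists (fun p => g <| <|pi1 p, pi1 (pi2 p)|>, pi2 (pi2 p)|>); split.
- eapply (computable_comp Hg); computability.
- intros x; split.
  + intros [y Hy]; specialize (H <|x, y|>); revert H; unpair; intros H.
    apply H in Hy as [s Hs]; exists <|y, s|>; now unpair.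
  + intros [s Hs]; revert Hs; unpair; intros Hs; exists (pi1 s).
    specialize (H <|x, pi1 s|>); revert H; unpair; intros H; apply H; eauto.
Qed.

Lemma enumerable_eq f g :
  computable f -> computable g -> enumerable (fun x => f x = g x).
Proof.
intros Hf Hg.
apply enumerable_ext with (fun x => (f x - g x) + (g x - f x) = 0); [lia|].
apply enumerable_zero, computable_on_add; now apply computable_on_sub.
Qed.

Lemma enumerable_eval c f g :
  computable f -> computable g -> enumerable (fun x => eval c (f x) (g x)).
Proof.
intros Hf Hg.
apply enumerable_ext with (fun x => exists s, step c s (f x) = S (g x)).
- intros x; split.
  + intros [s Hs]; eapply step_sound; eauto.
  + intros H; destruct (step_complete H) as [s Hs]; exists s; auto.
- apply enumerable_ex, enumerable_eq.
  + apply computable_on_app2; [apply step_computable|computability|].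
    eapply (computable_comp Hf); computability.
  + apply computable_on_succ.
    eapply (computable_comp Hg); computability.
Qed.

Lemma eval_search g c x :
  (forall p, eval c p (g p)) ->
  (exists s, g <|x, s|> = 0) -> exists n, eval (cMu c) x n.
Proof.
intros Hc [s Hs].
assert (exists n, g <|x, n|> = 0 /\ forall m, m < n -> g <|x, m|> <> 0)
  as [n [H0 Hlt]].
{ revert Hs; induction s as [s IH] using lt_wf_ind; intros Hs.
  destruct (classic (exists m, m < s /\ g <|x, m|> = 0)) as [[m [Hm E]]|N].
  - now apply (IH m).
  - exists s; split; trivial; intros m Hm E; eauto. }
exists n; apply eval_mu with (fun m => pred (g <|x, m|>)).
- intros m Hm; rewrite Nat.succ_pred by auto; apply Hc.
- rewrite <- H0; apply Hc.
Qed.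

Lemma eval_mu_root c x n : eval (cMu c) x n -> eval c <|x, n|> 0.
Proof. now inversion 1. Qed.

(** Every c.e. predicate is the domain of a program. *)
Lemma enumerable_domain P :
  enumerable P -> exists c, forall x, P x <-> exists y, eval c x y.
Proof.
intros [g [[c Hc] H]]; exists (cMu c); intros x; rewrite H; split.
- apply eval_search; auto.
- intros [n Hn]; exists n; apply eval_mu_root in Hn.
  apply (eval_functional (Hc _ I) Hn).
Qed.

(** A c.e. relation has a computable selector: the first witness found in a
    search through all candidates and all bounds. *)
Lemma enumerable_uniformization (P : nat -> nat -> Prop) :
  enumerable (fun p => P (pi1 p) (pi2 p)) ->
  exists c, forall x,
    (forall y, eval c x y -> P x y) /\
    ((exists y, P x y) -> exists y, eval c x y).
Proof.
intros [g [Hg H]].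
assert (computable (fun p => g <| <|pi1 p, pi1 (pi2 p)|>, pi2 (pi2 p)|>))
  as [c Hc].
{ eapply (computable_comp Hg); computability. }
exists (cComp cFst (cMu c)); intros x; split.
- intros y Hy; inversion Hy as [| | | | |? ? ? r ? Hr Hf| | |]; subst.
  apply eval_mu_root, (eval_functional (Hc _ I)) in Hr.
  assert (y = pi1 r) as ->.
  { inversion Hf; subst; now unpair. }
  specialize (H <|x, pi1 r|>); revert H Hr; unpair; intros H Hr; apply H; eauto.
- intros [y Hy].
  destruct (eval_search (g := fun p => g <| <|pi1 p, pi1 (pi2 p)|>, pi2 (pi2 p)|>)
    (c := c) (x := x)) as [n Hn]; auto.
  + specialize (H <|x, y|>); revert H; unpair; intros H.
    apply H in Hy as [s Hs]; exists <|y, s|>; now unpair.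
  + exists (pi1 n); eapply eval_comp; [exact Hn|].
    rewrite <- (pair_pi n) at 1; constructor.
Qed.

Lemma W_encode c x : W (encode c) x <-> exists y, eval c x y.
Proof.
split.
- intros [d [y [E H]]]; apply encode_inj in E as ->; eauto.
- intros [y H]; exists c, y; auto.
Qed.

(** The index of the program that runs program [e] on [<|q, x|>] for input [x].
    The recursion computes the Goedel number of [cConst q]. *)
Definition smn (e q : nat) : nat :=
  <|5, <|e, <|4, <|prec <|0, 0|> (fun _ r => <|5, <| <|1, 0|>, r|> |>) q,
                   encode cId|> |> |> |>.

Lemma smn_encode c q : smn (encode c) q = encode (cComp c (cPair (cConst q) cId)).
Proof.
assert (E : forall k, prec <|0, 0|> (fun _ r => <|5, <| <|1, 0|>, r|> |>) k
                      = encode (cConst k)).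
{ intros k; induction k as [|k IH]; cbn [prec cConst encode]; trivial.
  now rewrite IH. }
unfold smn; rewrite E; reflexivity.
Qed.

Lemma computable_on_smn D f g :
  computable_on D f -> computable_on D g ->
  computable_on D (fun x => smn (f x) (g x)).
Proof. intros Hf Hg; unfold smn; computability. Qed.

(** The index of [w |-> e (<| <|e, q|>, w|>)], where program [e] receives its
    own Goedel number. *)
Definition self_index (e q : nat) : nat := smn e <|e, q|>.

(** A uniformly c.e. family of sets may refer to its own indices: [P] may mention
    [self_index e], and for the right [e] these indices describe [P e]. *)
Lemma self_reference (P : nat -> nat -> nat -> Prop) :
  enumerable (fun p => P (pi1 (pi1 p)) (pi2 (pi1 p)) (pi2 p)) ->
  exists e, forall q w, W (self_index e q) w <-> P e q w.
Proof.
intros HP; destruct (enumerable_domain HP) as [c Hc].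
exists (encode c); intros q w; unfold self_index.
rewrite smn_encode, W_encode.
specialize (Hc <| <|encode c, q|>, w|>); revert Hc; unpair; intros ->.
split; intros [y Hy].
- inversion Hy as [| | | | |? ? ? z ? Hz Hf| | |]; subst; exists y.
  assert (E : eval (cPair (cConst <|encode c, q|>) cId) w <| <|encode c, q|>, w|>)
    by (apply eval_pair; [apply eval_const|apply eval_id]).
  now rewrite (eval_functional E Hz).
- exists y; eapply eval_comp; [|exact Hy].
  apply eval_pair; [apply eval_const|apply eval_id].
Qed.

(** * Intervals, clipping and switches *)

(** The ends of the interval coded by [n]; they are always ordered. *)
Definition lo (n : nat) : nat := pi1 n.
Definition hi (L : ce_prelattice) (n : nat) : nat := join L (pi1 n) (pi2 n).

(** The projection of [x] to the interval [n]. *)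
Definition clip (L : ce_prelattice) (n x : nat) : nat :=
  join L (lo n) (meet L (hi L n) x).

(** The join of [t n] and of the meets of [g k] with [t k] for [k < i]: the
    switch [t k] lets the element [g k] through. *)
Definition mix (L : ce_prelattice) (n : nat) (t g : nat -> nat) (i : nat) : nat :=
  prec (t n) (fun k r => join L (meet L (g k) (t k)) r) i.

(** The intervals [n] and [m] have equivalent ends. *)
Definition same_interval (L : ce_prelattice) (n m : nat) : Prop :=
  equiv L (lo n) (lo m) /\ equiv L (hi L n) (hi L m).

Lemma lo_le_hi L n : leL L (lo n) (hi L n).
Proof. apply join_gel. Qed.

Lemma lo_le_clip L n x : leL L (lo n) (clip L n x).
Proof. apply join_gel. Qed.

Lemma clip_le_hi L n x : leL L (clip L n x) (hi L n).
Proof. apply join_lub; [apply lo_le_hi|apply meet_lel]. Qed.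

Lemma clip_le L n x y : leL L (lo n) y -> leL L x y -> leL L (clip L n x) y.
Proof.
intros Hl Hx; apply join_lub; trivial.
eapply le_trans; [apply meet_ler|exact Hx].
Qed.

Lemma le_clip L n x y : leL L y (hi L n) -> leL L y x -> leL L y (clip L n x).
Proof.
intros Hh Hx; eapply le_trans; [|apply join_ger]; now apply meet_glb.
Qed.

Lemma mix_le L n t g y i :
  leL L (t n) y -> (forall k, k < i -> leL L (meet L (g k) (t k)) y) ->
  leL L (mix L n t g i) y.
Proof.
intros H0 H; induction i as [|i IH]; cbn; trivial.
apply join_lub; [apply H; lia|apply IH; intros; apply H; lia].
Qed.

Lemma default_le_mix L n t g i : leL L (t n) (mix L n t g i).
Proof.
induction i as [|i IH]; cbn; [apply le_refl|].
eapply le_trans; [exact IH|apply join_ger].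
Qed.

Lemma le_mix L n t g i k : k < i -> leL L (meet L (g k) (t k)) (mix L n t g i).
Proof.
induction i as [|i IH]; [lia|]; intros Hk; cbn.
destruct (Nat.eq_dec k i) as [->|]; [apply join_gel|].
eapply le_trans; [apply IH; lia|apply join_ger].
Qed.

(** * Course-of-values recursion *)

(** [table G n] codes the values at [0, ..., n - 1] of the function defined from
    [G], which receives the argument and the table of the earlier values. *)
Fixpoint table (G : nat -> nat -> nat) (n : nat) : nat :=
  match n with 0 => 0 | S n => <|table G n, G n (table G n)|> end.

(** The entry that is [j] places before the last one. *)
Definition lookup (T j : nat) : nat := pi2 (prec T (fun _ r => pi1 r) j).

Lemma lookup_table G n i :
  i < n -> lookup (table G n) (n - S i) = G i (table G i).
Proof.
intros Hi; unfold lookup.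
assert (E : forall j, j <= n ->
  prec (table G n) (fun _ r => pi1 r) j = table G (n - j)).
{ intros j; induction j as [|j IH]; cbn [prec]; intros Hj.
  - now rewrite Nat.sub_0_r.
  - rewrite IH by lia; replace (n - j) with (S (n - S j)) by lia.
    cbn [table]; now unpair. }
rewrite E by lia; replace (n - (n - S i)) with (S i) by lia.
cbn [table]; now unpair.
Qed.

(** The interpolant for the interval [n], computed from the switches
    [t <|e, <|n, k|> |>] and the table [T] of the earlier interpolants. *)
Definition body (L : ce_prelattice) (t : nat -> nat) (e n T : nat) : nat :=
  clip L n (mix L n (fun k => t <|e, <|n, k|> |>) (fun i => lookup T (n - S i)) n).

(** The interpolants, uniformly in [e], which will be the Goedel number that the
    switches depend on. *)
Definition interpolant (L : ce_prelattice) (t : nat -> nat) (e n : nat) : nat :=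
  body L t e n (table (body L t e) n).

Lemma interpolant_eq L t e n :
  interpolant L t e n =
  clip L n (mix L n (fun k => t <|e, <|n, k|> |>) (interpolant L t e) n).
Proof.
unfold interpolant at 1, body at 1; f_equal; unfold mix.
assert (E : forall i, i <= n ->
  prec (t <|e, <|n, n|> |>) (fun k r => join L (meet L
     (lookup (table (body L t e) n) (n - S k)) (t <|e, <|n, k|> |>)) r) i =
  prec (t <|e, <|n, n|> |>) (fun k r => join L (meet L
     (interpolant L t e k) (t <|e, <|n, k|> |>)) r) i); [|now apply E].
intros i; induction i as [|i IH]; cbn; trivial; intros Hi.
rewrite IH, lookup_table by lia; reflexivity.
Qed.

(** The switches are given by a partial function, defined on [D'].  A single
    program works for every [e] for which all switches are defined. *)
Lemma interpolant_computable_on L t D' D :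
  computable_on D' t -> (forall e q, D e -> D' <|e, q|>) ->
  computable_on (fun p => D (pi1 p)) (fun p => interpolant L t (pi1 p) (pi2 p)).
Proof.
intros Ht HD.
assert (Hm := fun D a b => @computable_on_op2 D _ a b (meet_computable L)).
assert (Hj := fun D a b => @computable_on_op2 D _ a b (join_computable L)).
assert (Hs := @computable_on_sub).
assert (Hl : forall D a b, computable_on D a -> computable_on D b ->
  computable_on D (fun x => lookup (a x) (b x))).
{ intros E a b Ha Hb; apply (@computable_on_app2 E lookup); trivial.
  unfold lookup, computable; computability. }
assert (Hb : computable_on (fun p => D (pi1 p))
  (fun p => body L t (pi1 p) (pi1 (pi2 p)) (pi2 (pi2 p)))).
{ assert (Ht' : forall a n k, computable_on (fun p => D (a p)) a ->
    computable_on (fun p => D (a p)) n -> computable_on (fun p => D (a p)) k ->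
    computable_on (fun p => D (a p)) (fun p => t <|a p, <|n p, k p|> |>)).
  { intros a n k Ha Hn Hk; eapply computable_on_comp; [exact Ht| |].
    - computability.
    - intros p Hp; now apply HD. }
  unfold body, clip, mix, hi, lo.
  computability_with ltac:(first [apply Hj|apply Hm|apply Hl|apply Hs|apply Ht']). }
assert (Hb' : forall D0 a n T, computable_on D0 a -> computable_on D0 n ->
  computable_on D0 T -> (forall p, D0 p -> D (a p)) ->
  computable_on D0 (fun p => body L t (a p) (n p) (T p))).
{ intros D0 a n T Ha Hn HT H; eapply computable_on_app3; eauto.
  intros p Hp; cbv beta; unpair; auto. }
unfold interpolant; apply Hb'; computability; auto.
apply computable_on_ext with (fun p => prec 0
   (fun n r => <|r, body L t (pi1 p) n r|>) (pi2 p)).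
{ intros p _; induction (pi2 p) as [|n IH]; cbn; congruence. }
computability; apply Hb'; computability; auto.
Qed.

(** * Events and their effect *)

(** Reflexivity makes the c.e. set nonempty, so its index is a Goedel number. *)
Lemma leL_enumerable L f g :
  computable f -> computable g -> enumerable (fun x => leL L (f x) (g x)).
Proof.
intros Hf Hg; destruct (le_ce L) as [e He].
destruct (proj1 (He 0 0) (le_refl L 0)) as [c [_ [<- _]]].
apply enumerable_ext with (fun x => exists y, eval c <|f x, g x|> y).
- intros x; now rewrite He, W_encode.
- apply enumerable_ex, enumerable_eval; computability_with
    ltac:(first [eapply (computable_comp Hf)|eapply (computable_comp Hg)]).
Qed.

(** The events for the interval [n] with interpolant [y], numbered by [k]. *)
Definition event (L : ce_prelattice) (n y k : nat) : Prop :=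
  (k < n /\ same_interval L n k) \/
  (k = n /\ leL L y (lo n)) \/
  (k = S n /\ leL L (hi L n) y).

Lemma same_interval_sym L n m : same_interval L n m -> same_interval L m n.
Proof. firstorder. Qed.

Lemma same_interval_trans L n m k :
  same_interval L n m -> same_interval L m k -> same_interval L n k.
Proof.
intros [[] []] [[] []]; repeat split; eapply le_trans; eassumption.
Qed.

(** Event [k'] occurs, and it has set the switches [t] for the interval [n]: the
    switch [k'] to the upper end and all others to the lower end. *)
Definition forces (L : ce_prelattice) (t f : nat -> nat) (n k' : nat) : Prop :=
  event L n (f n) k' /\
  forall k, equiv L (t k) (if k =? k' then hi L n else lo n).

Section Interpolation.

Variables (L : ce_prelattice) (t : nat -> nat -> nat) (f : nat -> nat).
Hypothesis f_eq : forall n, f n = clip L n (mix L n (t n) f n).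
Hypothesis first_event : forall n k, ~ leL L (hi L n) (lo n) ->
  event L n (f n) k -> exists k', forces L (t n) f n k'.

Lemma lo_le n : leL L (lo n) (f n).
Proof. rewrite f_eq; apply lo_le_clip. Qed.

Lemma le_hi n : leL L (f n) (hi L n).
Proof. rewrite f_eq; apply clip_le_hi. Qed.

(** In a proper interval only an equivalence with an earlier interval can be the
    first event; the other two events refute themselves. *)
Lemma first_event_is_repetition n k :
  ~ leL L (hi L n) (lo n) -> event L n (f n) k ->
  exists m, m < n /\ same_interval L n m /\ equiv L (f n) (f m).
Proof.
intros Hlt Hk; destruct (first_event Hlt Hk) as [k' [He Ht]].
destruct He as [[Hm Hs]|[[-> Hle]|[-> Hle]]].
- exists k'; split; [|split]; trivial.
  assert (Hl : leL L (lo n) (f k')).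
  { eapply le_trans; [apply Hs|apply lo_le]. }
  assert (Hh : leL L (f k') (hi L n)).
  { eapply le_trans; [apply le_hi|apply Hs]. }
  assert (Hne : forall k, k <> k' -> leL L (t n k) (f k')).
  { intros k'' E; eapply le_trans; [|exact Hl].
    specialize (Ht k''); apply Nat.eqb_neq in E; rewrite E in Ht; apply Ht. }
  rewrite f_eq; split.
  + apply clip_le; trivial; apply mix_le; [apply Hne; lia|].
    intros k'' _; destruct (Nat.eq_dec k'' k') as [->|E]; [apply meet_lel|].
    eapply le_trans; [apply meet_ler|now apply Hne].
  + apply le_clip; trivial.
    eapply le_trans; [|apply (@le_mix L n (t n) f n k' Hm)].
    apply meet_glb; [apply le_refl|].
    specialize (Ht k'); rewrite Nat.eqb_refl in Ht.
    eapply le_trans; [exact Hh|apply Ht].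
- (* Event [n]: the switch [n] forces [f n] up to [hi n]. *)
  destruct Hlt; eapply le_trans; [|exact Hle]; rewrite f_eq.
  apply le_clip; [apply le_refl|].
  eapply le_trans; [|apply default_le_mix].
  specialize (Ht n); rewrite Nat.eqb_refl in Ht; apply Ht.
- (* Event [S n]: all switches up to [n] force [f n] down to [lo n]. *)
  destruct Hlt; eapply le_trans; [exact Hle|]; rewrite f_eq.
  assert (Hne : forall k, k <= n -> leL L (t n k) (lo n)).
  { intros k'' E; specialize (Ht k''); assert (k'' <> S n) as E' by lia.
    apply Nat.eqb_neq in E'; rewrite E' in Ht; apply Ht. }
  apply clip_le; [apply le_refl|apply mix_le]; auto.
  intros k'' Hk''; eapply le_trans; [apply meet_ler|apply Hne; lia].
Qed.

Lemma interpolant_strict n :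
  ~ leL L (hi L n) (lo n) -> ~ leL L (f n) (lo n) /\ ~ leL L (hi L n) (f n).
Proof.
induction n as [n IH] using lt_wf_ind; intros Hlt.
destruct (classic (exists k, event L n (f n) k)) as [[k Hk]|N].
- destruct (first_event_is_repetition Hlt Hk) as [m [Hm [[[A1 A2] [A3 A4]] [A5 A6]]]].
  destruct (IH m Hm) as [S1 S2].
  + intros H; apply Hlt.
    eapply le_trans; [|eapply le_trans; [exact H|]]; trivial.
  + split; intros H; [apply S1|apply S2];
      (eapply le_trans; [|eapply le_trans; [exact H|]]; trivial).
- split; intros H; apply N; [exists n|exists (S n)]; unfold event; auto.
Qed.

Lemma interpolant_extensional n m : same_interval L n m -> equiv L (f n) (f m).
Proof.
(* Induction on a common bound: the first event for the larger of two equivalent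
   intervals leads to an interval that may be on either side of the smaller. *)
assert (K : forall N n m, n < N -> m < N ->
  same_interval L n m -> equiv L (f n) (f m)).
2: { apply (K (S (n + m))); lia. }
clear n m; intros N; induction N as [|N IH]; [lia|].
assert (K : forall m, m < N -> same_interval L N m -> equiv L (f N) (f m)).
{ intros m Hm Hs; destruct (classic (leL L (hi L N) (lo N))) as [H|H].
  - destruct Hs as [[] []]; split.
    + eapply le_trans; [apply le_hi|].
      eapply le_trans; [exact H|].
      eapply le_trans; [eassumption|apply lo_le].
    + eapply le_trans; [apply le_hi|].
      eapply le_trans; [eassumption|].
      eapply le_trans; [exact H|apply lo_le].
  - destruct (@first_event_is_repetition N m H) as [k [Hk [Hs' [E1 E2]]]].
    { left; auto. }
    destruct (IH k m) as [E3 E4]; trivial.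
    + eapply same_interval_trans; [apply same_interval_sym|]; eassumption.
    + split; eapply le_trans; eassumption. }
intros n m Hn Hm Hs.
destruct (Nat.eq_dec n N) as [->|], (Nat.eq_dec m N) as [->|].
- split; apply le_refl.
- apply K; trivial; lia.
- apply same_interval_sym, K in Hs; [|lia]; destruct Hs; split; trivial.
- apply IH; trivial; lia.
Qed.

End Interpolation.

(** * Switches from the productive function *)

Lemma event_enumerable L n y k :
  computable n -> computable y -> computable k ->
  enumerable (fun p => event L (n p) (y p) (k p)).
Proof.
intros Hn Hy Hk.
assert (Hj := fun D a b => @computable_on_op2 D _ a b (join_computable L)).
unfold event, same_interval, equiv, equiv_of, lo, hi.
repeat first
  [ apply enumerable_or | apply enumerable_and | apply enumerable_lt
  | apply leL_enumerable | apply enumerable_eq ];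
  computability_with ltac:(apply Hj).
Qed.

(** A partial computable function extends to a total function. *)
Lemma partial_choice c :
  exists t, forall x y, eval c x y -> t x = y.
Proof.
destruct (functional_choice (fun x z => forall y, eval c x y -> z = y))
  as [t Ht]; [|eauto].
intros x; destruct (classic (exists y, eval c x y)) as [[z Hz]|N].
- exists z; intros y Hy; eapply eval_functional; eauto.
- exists 0; intros y Hy; destruct N; eauto.
Qed.

(** Self-referential indices of the two sets given to the productive function
    for the switch [k] of the interval [n]. *)
Definition left_index (e n k : nat) : nat := self_index e <|0, <|n, k|> |>.
Definition right_index (e n k : nat) : nat := self_index e <|1, <|n, k|> |>.

Lemma computable_on_self_index D f g :
  computable_on D f -> computable_on D g ->
  computable_on D (fun x => self_index (f x) (g x)).
Proof.
intros Hf Hg; apply computable_on_smn; trivial; now apply computable_on_pair.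
Qed.

(** The switches exist, together with computable interpolants. *)
Lemma forcing_system L (hL : uei L) :
  exists t f, computable f /\
    (forall n, f n = clip L n (mix L n (t n) f n)) /\
    (forall n k, ~ leL L (hi L n) (lo n) ->
      event L n (f n) k -> exists k', forces L (t n) f n k').
Proof.
destruct hL as [_ [chi [[cchi Hchi] Hei]]].
assert (Hj := fun D a b => @computable_on_op2 D _ a b (join_computable L)).
assert (Hid : computable (fun x => x)) by apply computable_on_id.
(* [ct] computes the switch, as a productive value.  This need not exist in a
   collapsed interval, where any value will do. *)
destruct (@enumerable_uniformization
  (fun x z => let e := pi1 x in let n := pi1 (pi2 x) in let k := pi2 (pi2 x) in
    chi (lo n) (hi L n) (left_index e n k) (right_index e n k) z \/
    leL L (hi L n) (lo n))) as [ct Hct].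
{ cbv zeta beta.
  apply enumerable_or; unfold lo, hi, left_index, right_index.
  - eapply enumerable_ext; [intros x; symmetry; apply Hchi|].
    apply enumerable_eval;
      computability_with ltac:(first [apply Hj|apply computable_on_self_index]).
  - apply leL_enumerable; computability_with ltac:(apply Hj). }
destruct (partial_choice ct) as [t Ht].
set (conv := fun e => forall q, exists y, eval ct <|e, q|> y).
(* [cf] computes the interpolants. *)
destruct (@interpolant_computable_on L t
  (fun p => exists y, eval ct p y) conv) as [cf Hcf].
{ exists ct; intros p [y Hy]; now rewrite (Ht _ _ Hy). }
{ auto. }
(* [cs] computes the first event. *)
destruct (@enumerable_uniformization
  (fun x k => exists y, eval cf x y /\ event L (pi2 x) y k)) as [cs Hcs].
{ apply (@enumerable_ex (fun p y => eval cf (pi1 p) y /\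
    event L (pi2 (pi1 p)) y (pi2 p))).
  apply enumerable_and; [apply enumerable_eval|apply event_enumerable];
    computability. }
(* The sets of the left indices ([i = 0]) and of the right indices ([i > 0]). *)
destruct (@self_reference (fun e q w =>
  let i := pi1 q in let n := pi1 (pi2 q) in let k := pi2 (pi2 q) in
  (i = 0 /\ (equiv L (lo n) w \/
     eval cs <|e, n|> k /\ eval ct <|e, <|n, k|> |> w)) \/
  (0 < i /\ (equiv L (hi L n) w \/
     (exists k', eval cs <|e, n|> k' /\ (k' < k \/ k < k')) /\
      eval ct <|e, <|n, k|> |> w)))) as [e He].
{ cbv zeta; unfold equiv, equiv_of, lo, hi.
  repeat first
    [ apply enumerable_or | apply enumerable_and | apply enumerable_lt
    | apply leL_enumerable | apply enumerable_eq | apply enumerable_eval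
    | match goal with |- enumerable (fun p => exists y, @?P p y) =>
        apply (@enumerable_ex P) end ];
    computability_with ltac:(apply Hj). }
assert (Hl : forall n k w, W (left_index e n k) w <->
  equiv L (lo n) w \/ eval cs <|e, n|> k /\ eval ct <|e, <|n, k|> |> w).
{ intros n k w; unfold left_index; rewrite He; cbv zeta; unpair.
  split; [intros [[_ H]|[H _]]; [exact H|lia]|intros H; left; auto]. }
assert (Hr : forall n k w, W (right_index e n k) w <->
  equiv L (hi L n) w \/
  (exists k', eval cs <|e, n|> k' /\ (k' < k \/ k < k')) /\
   eval ct <|e, <|n, k|> |> w).
{ intros n k w; unfold right_index; rewrite He; cbv zeta; unpair.
  split; [intros [[H _]|[_ H]]; [lia|exact H]|intros H; right; split; [lia|exact H]]. }
assert (Hct' : forall n k z, eval ct <|e, <|n, k|> |> z ->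
  chi (lo n) (hi L n) (left_index e n k) (right_index e n k) z \/
  leL L (hi L n) (lo n)).
{ intros n k z Hz; apply Hct in Hz; revert Hz; cbv zeta; now unpair. }
assert (Hprod : forall n k, ~ leL L (hi L n) (lo n) ->
  disjoint (W (left_index e n k)) (W (right_index e n k)) ->
  exists z, chi (lo n) (hi L n) (left_index e n k) (right_index e n k) z /\
    ~ W (left_index e n k) z /\ ~ W (right_index e n k) z).
{ intros n k Hlt Hd; destruct (Hei (lo n) (hi L n)) as [_ [_ H]].
  - intros [_ H]; auto.
  - apply H; trivial; intros w Hw; [apply Hl|apply Hr]; left; exact Hw. }
assert (Hapart : forall n w, ~ leL L (hi L n) (lo n) ->
  equiv L (lo n) w -> ~ equiv L (hi L n) w).
{ intros n w Hlt H1 H2; apply Hlt; eapply le_trans; [apply H2|apply H1]. }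
(* If the switch were undefined, the two sets would be just the classes of the
   ends, and productiveness would define it. *)
assert (Hconv : conv e).
{ intros q; rewrite <- (pair_pi q); generalize (pi1 q), (pi2 q); intros n k.
  apply NNPP; intros N.
  assert (N' : forall z, ~ (chi (lo n) (hi L n) (left_index e n k)
    (right_index e n k) z \/ leL L (hi L n) (lo n))).
  { intros z Hz; apply N; apply Hct; exists z; cbv zeta; now unpair. }
  assert (Hlt : ~ leL L (hi L n) (lo n)).
  { intros H; apply (N' 0); auto. }
  destruct (Hprod n k Hlt) as [z [Hz _]]; [|apply (N' z); auto].
  intros w [H1 H2]; apply Hl in H1 as [H1|[_ H1]]; [|apply N; eauto].
  apply Hr in H2 as [H2|[_ H2]]; [|apply N; eauto].
  exact (Hapart n w Hlt H1 H2). }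
assert (Ht' : forall n k, eval ct <|e, <|n, k|> |> (t <|e, <|n, k|> |>)).
{ intros n k; destruct (Hconv <|n, k|>) as [y Hy]; now rewrite (Ht _ _ Hy). }
assert (Hf : forall n, eval cf <|e, n|> (interpolant L t e n)).
{ intros n; specialize (Hcf <|e, n|>); cbv beta in Hcf; revert Hcf; unpair; auto. }
exists (fun n k => t <|e, <|n, k|> |>), (interpolant L t e); split; [|split].
- exists (cComp cf (cPair (cConst e) cId)); intros n _.
  eapply eval_comp; [|apply Hf].
  apply eval_pair; [apply eval_const|apply eval_id].
- intros n; apply interpolant_eq.
- intros n k Hlt Hk.
  destruct (proj2 (Hcs <|e, n|>)) as [k' Hk'].
  { exists k, (interpolant L t e n); unpair; auto. }
  exists k'; split.
  { apply Hcs in Hk' as [y [Hy Hk']]; revert Hk'; unpair.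
    now rewrite (eval_functional Hy (Hf n)). }
  clear k Hk; intros k.
  assert (Hz : forall z, chi (lo n) (hi L n) (left_index e n k)
    (right_index e n k) z -> z = t <|e, <|n, k|> |>).
  { intros z Hz; destruct (Hct' n k _ (Ht' n k)) as [Hz'|]; [|contradiction].
    apply Hchi in Hz, Hz'; exact (eval_functional Hz Hz'). }
  (* If the switch is not in the class to which it should be forced, then the two
     sets are disjoint, but one of them contains the productive value. *)
  apply NNPP; intros N.
  destruct (Hprod n k Hlt) as [z [Hz1 [Hz2 Hz3]]];
    [|apply Hz in Hz1 as ->].
  + intros w [H1 H2].
    apply Hl in H1 as [H1|[H1 H1']]; apply Hr in H2 as [H2|[[k2 [H2 E]] H2']].
    * exact (Hapart n w Hlt H1 H2).
    * rewrite (eval_functional H2 Hk') in E.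
      destruct (Nat.eqb_spec k k'); [lia|].
      apply N; rewrite (eval_functional (Ht' n k) H2'); destruct H1; split; trivial.
    * rewrite (eval_functional H1 Hk'), Nat.eqb_refl in *.
      apply N; rewrite (eval_functional (Ht' n k') H1'); destruct H2; split; trivial.
    * rewrite (eval_functional H2 H1) in E; lia.
  + destruct (Nat.eqb_spec k k') as [->|E].
    * apply Hz2, Hl; right; auto.
    * apply Hz3, Hr; right; split; trivial; exists k'; split; trivial; lia.
Qed.

Theorem theorem47 (L : ce_prelattice) (hL : uei L) : uniformly_dense L.
Proof.
destruct (forcing_system hL) as [t [f [[c Hc] [Hf Hev]]]].
exists (fun a b => f <|a, b|>); split; [|split].
- exists c; intros a b; now apply Hc.
- intros a b [Hab Hba].
  assert (Hhi : equiv L (hi L <|a, b|>) b).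
  { unfold hi; unpair; split; [apply join_lub; trivial; apply le_refl|apply join_ger]. }
  assert (Hlo : lo <|a, b|> = a) by apply pi1_pair.
  destruct (@interpolant_strict L t f Hf Hev <|a, b|>) as [H1 H2].
  + rewrite Hlo; intros H; apply Hba; eapply le_trans; [apply Hhi|exact H].
  + rewrite Hlo in H1; repeat split; trivial.
    * rewrite <- Hlo at 1; eapply lo_le; eauto.
    * eapply le_trans; [eapply le_hi; eauto|apply Hhi].
    * intros H; apply H2; eapply le_trans; [apply Hhi|exact H].
- intros a b a' b' Ha Hb; apply (@interpolant_extensional L t f Hf Hev).
  split; unfold lo, hi; unpair; [exact Ha|now apply join_congr].
Qed.
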